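(* Let $(S,\lambda_S^\bullet,\mu_S^{(0)})$, $(G,\lambda_G^\bullet,\mu_G^{(0)})$, $(T,\lambda_T^\bullet,\mu_T^{(0)})$ be Haar groupoids and $p:S\to G$, $q:T\to G$ homomorphisms of Haar groupoids, with weak pullback $P$. For $u=(s,g,t)\in P^{(0)}$ put $\lambda_P^{u}=\lambda_S^s\times\delta_g\times\lambda_T^t$. Then $\lambda_P^\bullet=\{\lambda_P^u\}_{u\in P^{(0)}}$ is a continuous left Haar system for $P$.
   Context: For a groupoid $G$: unit space $G^{(0)}$, range/source $r,d$, $G^u=r^{-1}(u)$. A system of measures on a Borel map $\pi:X\to Y$ is a family $\{\lambda^y\}_{y\in Y}$ of positive Borel measures on $X$ with $\lambda^y$ concentrated on $\pi^{-1}(y)$. A continuous left Haar system on a groupoid $G$ is a system of measures $\lambda^\bullet$ on $r:G\to G^{(0)}$ which is continuous ($u\mapsto\int f\,d\lambda^u$ continuous on $G^{(0)}$ for every continuous compactly supported $f\ge0$ on $G$), left invariant ($\lambda^{d(x)}(E)=\lambda^{r(x)}(x\cdot(E\cap G^{d(x)}))$ for all $x\in G$ and Borel $E\subseteq G$), and positive on open sets ($\lambda^u(A)>0$ for every open $A$ with $A\cap G^u\ne\emptyset$). Induced measure of a Radon $\mu^{(0)}$ on $G^{(0)}$: $\mu(E)=\int\lambda^u(E)\,d\mu^{(0)}(u)$; $\mu^{(0)}$ is quasi-invariant if $\mu\sim\mu^{-1}$, $\mu^{-1}(E)=\mu(E^{-1})$. A Haar groupoid $(G,\lambda^\bullet,\mu^{(0)})$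 is a second countable, locally compact, Hausdorff topological groupoid with a continuous left Haar system and a non-zero quasi-invariant Radon measure on $G^{(0)}$. A homomorphism of Haar groupoids is a continuous groupoid homomorphism $p$ with $p_*(\mu)\sim\nu$ for the induced measures. The weak pullback is $P=\{(s,g,t)\in S\times G\times T: r_G(g)=r_G(p(s)),\ d_G(g)=r_G(q(t))\}$ with subspace topology; composable pairs $((s,g,t),(\sigma,h,\tau))$ are those with $r_S(\sigma)=d_S(s)$, $r_T(\tau)=d_T(t)$, $h=p(s)^{-1}gq(t)$, product $(s\sigma,g,t\tau)$, inverse $(s^{-1},p(s)^{-1}gq(t),t^{-1})$, $r_P(s,g,t)=(r_S(s),g,r_T(t))$, $d_P(s,g,t)=(d_S(s),p(s)^{-1}gq(t),d_T(t))$, and $P^{(0)}=\{(s,g,t):s\in S^{(0)},t\in T^{(0)},r_G(g)=p(s),d_G(g)=q(t)\}$. The measure $\lambda_S^s\times\delta_g\times\lambda_T^t$ is a measure on $S\times G\times T$ ($\delta_g$ the Dirac mass), regarded as a measure on $P$. *)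

(* Defs.v *)
From HB Require Import structures.
From mathcomp Require Import all_boot all_order all_algebra.
From mathcomp Require Import all_classical all_reals all_analysis.
Set Implicit Arguments.
Unset Strict Implicit.
Unset Printing Implicit Defensive.
Import Order.TTheory GRing.Theory Num.Theory.
Import numFieldNormedType.Exports.
Local Open Scope classical_set_scope.
Local Open Scope ring_scope.

(** Types carrying both a topology and a sigma-algebra (which we will
    require to be the Borel sigma-algebra). *)
HB.structure Definition TopMeasurable (d : measure_display) :=
  { T of Measurable d T & Topological T }.
Notation topMeasurableType := TopMeasurable.type.
(* products of such types are again such types (product topology and
   product sigma-algebra) *)
HB.saturate prod.

Definition borel_sigma d (X : topMeasurableType d) : Prop :=
  forall A : set X, measurable A <-> <<s [set U : set X | open U] >> A.

(** Groupoids (as small categories with inverses), with total operations on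
    a carrier type; [gcomp x y] means (x,y) is composable. *)
Record groupoid (X : Type) := Groupoid {
  gcomp : X -> X -> Prop;
  gmul : X -> X -> X;
  ginv : X -> X;
  gr : X -> X;
  gd : X -> X;
  gcompE : forall x y, gcomp x y <-> gd x = gr y;
  gmul_r : forall x y, gcomp x y -> gr (gmul x y) = gr x;
  gmul_d : forall x y, gcomp x y -> gd (gmul x y) = gd y;
  gmulA : forall x y z, gcomp x y -> gcomp y z ->
     gmul (gmul x y) z = gmul x (gmul y z);
  gr_unit : forall x, gr (gr x) = gr x /\ gd (gr x) = gr x;
  gd_unit : forall x, gr (gd x) = gd x /\ gd (gd x) = gd x;
  gmul_unitl : forall x, gmul (gr x) x = x;
  gmul_unitr : forall x, gmul x (gd x) = x;
  ginv_r : forall x, gr (ginv x) = gd x;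
  ginv_d : forall x, gd (ginv x) = gr x;
  gmulV : forall x, gmul x (ginv x) = gr x;
  gmulVl : forall x, gmul (ginv x) x = gd x
}.

Definition gunits (X : Type) (G : groupoid X) : set X := range (gr G).

Definition topological_groupoid (X : topologicalType) (G : groupoid X) :=
  {within [set xy : X * X | gcomp G xy.1 xy.2],
     continuous (fun xy : X * X => gmul G xy.1 xy.2)} /\
  continuous (ginv G).

Section HaarDefs.
Context (R : realType).
Local Open Scope ereal_scope.

Definition is_measure d (X : measurableType d) (m : set X -> \bar R) :=
  m set0 = 0 /\ (forall A, measurable A -> 0 <= m A) /\ semi_sigma_additive m.

(** Continuous left Haar system [lam] on a groupoid whose set of arrows is
    [Gs] (a subset of the ambient space X, with the subspace topology and the
    trace sigma-algebra), with unit space [U0], range [r], source [dd] and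
    multiplication [mul]. *)
Definition cont_left_Haar_system d (X : topMeasurableType d)
  (Gs U0 : set X) (r dd : X -> X) (mul : X -> X -> X)
  (lam : X -> set X -> \bar R) : Prop :=
  (forall u, U0 u ->
     is_measure (lam u) /\ lam u (~` [set x | Gs x /\ r x = u]) = 0) /\
  (forall f : X -> R,
     {within Gs, continuous f} ->
     (forall x, Gs x -> (0 <= f x)%R) ->
     (exists K : set X, [/\ compact K, K `<=` Gs &
                           forall x, Gs x -> ~ K x -> f x = 0%R]) ->
     (forall u, U0 u -> \int[lam u]_(x in Gs) (f x)%:E \is a fin_num) /\
     {within U0, continuous (fun u => fine (\int[lam u]_(x in Gs) (f x)%:E))})
  /\
  (forall x, Gs x -> forall E : set X, measurable E -> E `<=` Gs ->
     lam (dd x) E =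
     lam (r x) [set mul x y | y in [set y | E y /\ Gs y /\ r y = dd x]]) /\
  (forall u, U0 u -> forall O : set X, open O ->
     (exists x, [/\ O x, Gs x & r x = u]) -> 0 < lam u (O `&` Gs)).

(** Radon measure on the subspace [Y] of X, given as a measure on X
    concentrated on Y: locally finite, outer regular on Borel sets,
    inner regular (by compacts) on open sets. *)
Definition radon_on d (X : topMeasurableType d) (Y : set X)
  (mu : {measure set X -> \bar R}) : Prop :=
  mu (~` Y) = 0 /\
  (forall K, compact K -> K `<=` Y -> mu K < +oo) /\
  (forall A, measurable A -> A `<=` Y ->
     mu A = ereal_inf [set mu (O `&` Y) | O in [set O | open O /\ A `<=` O]]) /\
  (forall O, open O ->
     mu (O `&` Y) = ereal_sup [set mu K | K in [set K | compact K /\ K `<=` O `&` Y]]).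

Definition induced_measure d (X : topMeasurableType d) (G : groupoid X)
  (lam : X -> {measure set X -> \bar R}) (mu0 : {measure set X -> \bar R})
  (E : set X) : \bar R :=
  \int[mu0]_(u in gunits G) lam u E.

Definition quasi_invariant d (X : topMeasurableType d) (G : groupoid X)
  (lam : X -> {measure set X -> \bar R}) (mu0 : {measure set X -> \bar R}) :=
  forall E : set X, measurable E ->
    (induced_measure G lam mu0 E = 0 <->
     induced_measure G lam mu0 (ginv G @` E) = 0).

Definition haar_groupoid d (X : topMeasurableType d) (G : groupoid X)
  (lam : X -> {measure set X -> \bar R}) (mu0 : {measure set X -> \bar R}) :=
  [/\ borel_sigma X, @second_countable X, locally_compact [set: X],
      hausdorff_space X & topological_groupoid G] /\
  cont_left_Haar_system setT (gunits G) (gr G) (gd G) (gmul G)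
     (fun u => (lam u : set X -> \bar R)) /\
  radon_on (gunits G) mu0 /\ mu0 setT != 0 /\ quasi_invariant G lam mu0.

Definition haar_hom dS dG (S : topMeasurableType dS) (G : topMeasurableType dG)
  (GS : groupoid S) (lamS : S -> {measure set S -> \bar R})
  (muS : {measure set S -> \bar R})
  (GG : groupoid G) (lamG : G -> {measure set G -> \bar R})
  (muG : {measure set G -> \bar R}) (p : S -> G) :=
  continuous p /\
  (forall x y, gcomp GS x y ->
     gcomp GG (p x) (p y) /\ p (gmul GS x y) = gmul GG (p x) (p y)) /\
  (forall E : set G, measurable E ->
     (induced_measure GS lamS muS (p @^-1` E) = 0 <->
      induced_measure GG lamG muG E = 0)).

End HaarDefs.

Section WeakPullback.
Context (S G T : Type) (GS : groupoid S) (GG : groupoid G) (GT : groupoid T)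
  (p : S -> G) (q : T -> G).

Definition wpb : set (S * G * T) :=
  [set x | gr GG x.1.2 = gr GG (p x.1.1) /\ gd GG x.1.2 = gr GG (q x.2)].

Definition wpb_units : set (S * G * T) :=
  [set x | [/\ gunits GS x.1.1, gunits GT x.2,
              gr GG x.1.2 = p x.1.1 & gd GG x.1.2 = q x.2]].

Definition wpb_r (x : S * G * T) : S * G * T :=
  (gr GS x.1.1, x.1.2, gr GT x.2).

Definition wpb_d (x : S * G * T) : S * G * T :=
  (gd GS x.1.1, gmul GG (gmul GG (ginv GG (p x.1.1)) x.1.2) (q x.2), gd GT x.2).

Definition wpb_mul (x y : S * G * T) : S * G * T :=
  (gmul GS x.1.1 y.1.1, x.1.2, gmul GT x.2 y.2).

End WeakPullback.

Definition wpb_lam (R : realType) dS dG dT (S : topMeasurableType dS)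
  (G : topMeasurableType dG) (T : topMeasurableType dT)
  (lamS : S -> {measure set S -> \bar R}) (lamT : T -> {measure set T -> \bar R})
  (u : S * G * T) : set (S * G * T) -> \bar R :=
  ((lamS u.1.1 \x \d_(u.1.2)) \x lamT u.2)%E.

(* Main.v *)
Require Import Defs.
From HB Require Import structures.
From mathcomp Require Import all_boot all_order all_algebra.
From mathcomp Require Import all_classical all_reals all_analysis.
From mathcomp Require Import measurable_realfun.
Set Implicit Arguments.
Unset Strict Implicit.
Unset Printing Implicit Defensive.
Import Order.TTheory GRing.Theory Num.Theory.
Import numFieldNormedType.Exports.
Local Open Scope classical_set_scope.
Local Open Scope ring_scope.

(** Write [P] for the weak pullback. For a unit [u = (s, g, t)] of [P], the
    measure [lamP u] is the image of [lamS s * lamT t] under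
    [(a, b) |-> (a, g, b)], so integrals against it are iterated integrals over
    [S] and [T]; Haar measures are locally finite, hence sigma-finite here, and
    Tonelli applies.

    Left invariance: [y |-> x^-1 y] pushes [lam (r x)] forward to [lam (d x)] in
    [S] and in [T], and the middle coordinate is a Dirac mass on both sides.

    Continuity: [P] is closed, so a compactly supported [f >= 0] on [P] extends
    to a compactly supported continuous [F >= 0] on [S * G * T] (Tietze, in the
    one-point compactification). If [F] on [X * Z] vanishes for [x] outside a
    compact set, then [(u, z) |-> \int F (x, z) dlam^{r u}(x)] is jointly
    continuous: by compactness [|F (x, z) - F (x, z0)| <= e * phi x] for [z] near
    [z0], with a fixed compactly supported [phi]. Apply this to [T], then [S]. *)

(** * Extension of functions on locally compact spaces *)

Section LocallyCompact.
Context (R : realType) (X : topologicalType).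
Hypothesis lcX : locally_compact [set: X].
Hypothesis hX : hausdorff_space X.

Local Notation opc := (one_point_compactification X).

Lemma opc_normal : normal_space opc.
Proof.
apply: compact_normal; first exact: one_point_compactification_hausdorff.
exact: one_point_compactification_compact.
Qed.

Lemma opc_closed_some (K : set X) : compact K -> closed (Some @` K : set opc).
Proof.
move=> cK; apply: compact_closed.
  exact: one_point_compactification_hausdorff.
apply: continuous_compact cK.
exact/continuous_subspaceT/one_point_compactification_some_continuous.
Qed.

(** Urysohn's lemma in the one-point compactification separates the point at infinity from [K]; a
    cutoff then makes the function vanish on a whole neighbourhood of infinity. *)
Lemma compact_bump (K : set X) : compact K ->
  exists (g : X -> R) (W : set X), [/\ continuous g, (forall x, 0 <= g x),
    (forall x, K x -> g x = 1), compact W & forall x, ~ W x -> g x = 0].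
Proof.
move=> cK.
have cN : closed ([set None] : set opc).
  apply: compact_closed; first exact: one_point_compactification_hausdorff.
  exact: compact_set1.
have [] :=
  @urysohn_ext_itv _ R opc_normal _ _ 0 1 cN (opc_closed_some cK) _ ltr01.
  by rewrite -subset0 => -[x|] [] //= _ [].
move=> f [cf f0 f1 _].
have fN : f None = 0 by apply: f0; exists None.
have : nbhs (None : opc) [set o | f o < 2^-1].
  apply: (cf None [set y | y < 2^-1]); apply: open_nbhs_nbhs; split => /=.
    exact: open_lt.
  by rewrite fN invr_gt0.
case=> W [cW _] WN.
(* [max 0 (2 f - 1)] is [1] where [f = 1] and [0] where [f < 1/2], in particular off [W]. *)
exists (fun x => Num.max 0 (2 * f (Some x) - 1)), W; split => //.
- move=> x; apply: (@continuous_comp _ _ _ (Some : X -> opc)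
    (fun o => Num.max 0 (2 * f o - 1))).
    exact: one_point_compactification_some_continuous.
  apply: continuous_max; first exact: cvg_cst.
  apply: cvgB; last exact: cvg_cst.
  by apply: cvgM; [exact: cvg_cst|exact: cf].
- by move=> x; rewrite le_max lexx.
- move=> x Kx; rewrite (f1 (f (Some x))); last first.
    by exists (Some x) => //; exists x.
  by rewrite mulr1 -(natrB _ (leqnSn 1)) max_r.
- move=> x Wx; apply: max_l; rewrite subr_le0 -ler_pdivlMl// mulr1.
  by apply/ltW/WN; left; exists x.
Qed.

(** Tietze's theorem applies to the image of [A], which is closed in the compactification. Taking
    the positive part of the extension changes nothing on [A], where [f >= 0]. *)
Lemma compact_nonneg_extension (A : set X) (f : X -> R) : compact A ->
  {within A, continuous f} -> (forall x, A x -> 0 <= f x) ->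
  exists g : X -> R, [/\ continuous g, (forall x, 0 <= g x) &
    forall x, A x -> g x = f x].
Proof.
move=> cA cf f0.
(* The value at [None] is a placeholder: the image of [A] does not contain that point. *)
pose f' (o : opc) : R^o := if o is Some x then f x else 0.
have cf' : {within (Some @` A : set opc), continuous f'}.
  apply/subspace_continuousP => _ [x Ax <-] U /= Ux.
  have /subspace_continuousP/(_ x Ax U Ux) := cf.
  rewrite /nbhs /= /within /=.
  apply: filterS => z /= h [y Ay [yz]]; apply: h; by rewrite -yz.
(* Every number above [M] bounds [f] on [A]; [|M| + 1] is such a number and is also positive, as
   Tietze's theorem asks. *)
have [M [_ Mb]] := compact_bounded (continuous_compact cf cA).
have := @continuous_bounded_extension opc R opc_normal _ (opc_closed_some cA) f'
  (`|M| + 1) _ cf' _.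
case=> //.
  move=> _ [x Ax <-]; apply: Mb; last by exists x.
  by rewrite (le_lt_trans (ler_norm M))// ltrDl.
move=> g [fg cg _].
exists (fun x => Num.max 0 (g (Some x))); split.
- move=> x; apply: (@continuous_comp _ _ _ (Some : X -> opc)
    (fun o => Num.max 0 (g o))).
    exact: one_point_compactification_some_continuous.
  by apply: continuous_max; [exact: cvg_cst|exact: cg].
- by move=> x; rewrite le_max lexx.
- move=> x Ax; rewrite -fg ?inE; last by exists x.
  by rewrite /f' max_r// f0.
Qed.

(** Extend [f] from the compact set [W]&[A] and multiply by a bump [phi] equal to [1] on [K]: at a
    point of [W]&[A] either [phi = 1] or [f = 0], so the product is still [f]. *)
Lemma compact_support_extension (A K : set X) (f : X -> R) :
  closed A -> {within A, continuous f} -> (forall x, A x -> 0 <= f x) ->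
  compact K -> (forall x, A x -> ~ K x -> f x = 0) ->
  exists (g : X -> R) (W : set X), [/\ continuous g, (forall x, 0 <= g x),
    (forall x, A x -> g x = f x), compact W & forall x, ~ W x -> g x = 0].
Proof.
move=> cA cf f0 cK fK.
have [phi [W [cphi phi0 phi1 cW phiW]]] := compact_bump cK.
have WAW : W `&` A `<=` A by move=> x [].
have [h [ch h0 hf]] := compact_nonneg_extension (compact_closedI cW cA)
  (continuous_subspaceW WAW cf) (fun x WAx => f0 x (WAW x WAx)).
exists (fun x => h x * phi x), W; split => //.
- by move=> x; apply: cvgM; [exact: ch|exact: cphi].
- by move=> x; rewrite mulr_ge0.
- move=> x Ax; have [Wx|nWx] := pselect (W x).
    rewrite hf//; have [Kx|nKx] := pselect (K x); first by rewrite phi1// mulr1.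
    by rewrite fK// mul0r.
  (* [K] lies in [W], since [phi] is [1] on [K] and [0] off [W]. *)
  rewrite phiW// mulr0 fK// => Kx; apply: nWx; apply: contrapT => nWx.
  by move: (phi1 x Kx); rewrite phiW// => /esym/eqP; rewrite oner_eq0.
- by move=> x nWx; rewrite phiW// mulr0.
Qed.

End LocallyCompact.

(** * Products and Borel sets *)

Lemma fst_continuous (X Y : topologicalType) : continuous (@fst X Y).
Proof. by move=> [x y]; exact: cvg_fst. Qed.

Lemma snd_continuous (X Y : topologicalType) : continuous (@snd X Y).
Proof. by move=> [x y]; exact: cvg_snd. Qed.

Lemma continuous_pair (X Y Z : topologicalType) (f : X -> Y) (g : X -> Z) :
  continuous f -> continuous g -> continuous (fun x => (f x, g x)).
Proof.
move=> cf cg x; exact: (@cvg_pair _ _ _ (nbhs x) (nbhs (f x)) (nbhs (g x))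
  _ _ _ f g (cf x) (cg x)).
Qed.

Lemma id_continuous (X : topologicalType) : continuous (@id X).
Proof. by move=> x; exact: cvg_id. Qed.

Lemma continuousT_comp (X Y Z : topologicalType) (f : X -> Y) (g : Y -> Z) :
  continuous f -> continuous g -> continuous (fun x => g (f x)).
Proof. by move=> cf cg x; exact: continuous_comp (cf x) (cg (f x)). Qed.

Lemma openX (X Y : topologicalType) (A : set X) (B : set Y) :
  open A -> open B -> open (A `*` B).
Proof.
move=> oA oB; apply: (@openI _ (fst @^-1` A) (snd @^-1` B)).
- by move/continuousP : (@fst_continuous X Y); apply.
- by move/continuousP : (@snd_continuous X Y); apply.
Qed.

Lemma closedX (X Y : topologicalType) (A : set X) (B : set Y) :
  closed A -> closed B -> closed (A `*` B).
Proof.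
move=> cA cB; apply: (@closedI _ (fst @^-1` A) (snd @^-1` B)).
- by move/continuous_closedP : (@fst_continuous X Y); apply.
- by move/continuous_closedP : (@snd_continuous X Y); apply.
Qed.

Lemma closed_equalizer (X Y : topologicalType) (f g : X -> Y) :
  hausdorff_space Y -> continuous f -> continuous g ->
  closed [set x | f x = g x].
Proof.
move=> hY cf cg x clx; apply: hY => U V Ux Vx.
have nfU : nbhs x (f @^-1` U) by exact: cf.
have ngV : nbhs x (g @^-1` V) by exact: cg.
have [y [/= fg [Uy Vy]]] := clx _ (filterI nfU ngV).
by exists (f y); split => //; rewrite fg.
Qed.

Lemma continuous_within_comp (X Y Z : topologicalType) (D : set Y)
    (g : Y -> Z) (h : X -> Y) :
  {within D, continuous g} -> continuous h ->
  {within h @^-1` D, continuous (g \o h)}.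
Proof.
move=> /subspace_continuousP cg ch; apply/subspace_continuousP => x Dx U Ux.
by have := ch x _ (cg _ Dx _ Ux); rewrite /within.
Qed.

Lemma hausdorff_prod (X Y : topologicalType) :
  hausdorff_space X -> hausdorff_space Y -> hausdorff_space (X * Y)%type.
Proof.
move=> hX hY [x1 y1] [x2 y2] cl; congr pair.
- apply: hX => A B Ax By.
  have nA : nbhs (x1, y1) (A `*` setT).
    by exists (A, setT) => //; split => //; exact: filterT.
  have nB : nbhs (x2, y2) (B `*` setT).
    by exists (B, setT) => //; split => //; exact: filterT.
  by have [[a b] [[/= ? ?] [/= ? ?]]] := cl _ _ nA nB; exists a.
- apply: hY => A B Ax By.
  have nA : nbhs (x1, y1) (setT `*` A).
    by exists (setT, A) => //; split => //; exact: filterT.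
  have nB : nbhs (x2, y2) (setT `*` B).
    by exists (setT, B) => //; split => //; exact: filterT.
  by have [[a b] [[/= ? ?] [/= ? ?]]] := cl _ _ nA nB; exists b.
Qed.

Lemma locally_compact_prod (X Y : topologicalType) :
  locally_compact [set: X] -> locally_compact [set: Y] ->
  locally_compact [set: (X * Y)%type].
Proof.
move=> lX lY [x y] _.
have [U] := lX x I; rewrite withinET => Ux [cU clU].
have [V] := lY y I; rewrite withinET => Vy [cV clV].
exists (U `*` V); first by rewrite withinET; exists (U, V).
by split; [exact: compact_setX|exact: closedX].
Qed.

(** Indexed by a type, so that a product of bases is indexed by the product type and countability is
    carried by the indices. *)
Definition base (X : topologicalType) (I : Type) (B : I -> set X) :=
  (forall i, open (B i)) /\
  (forall x U, nbhs x U -> exists2 i, B i x & B i `<=` U).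

Lemma second_countable_base (X : topologicalType) :
  @second_countable X -> exists B : nat -> set X, base B.
Proof.
case=> B /countable_injP[f fi] [oB bB].
(* As [f] is injective on [B], this union is the one member with code [n], or empty if [n] codes
   none. *)
exists (fun n => \bigcup_(U in [set U | B U /\ f U = n]) U); split.
  by move=> n; apply: bigcup_open => U [/oB].
move=> x U /(bB x)[V [BV Vx] VU]; exists (f V); first by exists V.
move=> z [W [BW fWV] Wz]; apply: VU => /=.
by rewrite -(fi W V) ?inE.
Qed.

Lemma base_prod (X Y : topologicalType) (I J : Type)
    (B : I -> set X) (C : J -> set Y) :
  base B -> base C -> base (fun k : I * J => B k.1 `*` C k.2).
Proof.
move=> [oB bB] [oC bC]; split.
  by move=> [i j]; apply: openX; [exact: oB|exact: oC].
move=> [x y] W [[U V] [/= /bB[i ix iU] /bC[j jy jV]] UVW].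
exists (i, j) => // -[a b] [/= ? ?].
by apply: UVW; split; [exact: iU|exact: jV].
Qed.

Lemma base_bigcup (X : topologicalType) (I : Type) (B : I -> set X)
    (O : set X) :
  base B -> open O -> O = \bigcup_(i in [set i | B i `<=` O]) B i.
Proof.
move=> [oB bB] oO; apply/seteqP; split => [x Ox|x [i /= + Bx]]; last exact.
by have [|i ix iO] := bB x O; [exact: open_nbhs_nbhs|exists i].
Qed.

(** Countable bases make every open set a countable union of open rectangles, so the product
    sigma-algebra contains the Borel sets of the product topology. *)
Lemma open_measurable_prod d1 d2 (X : topMeasurableType d1)
    (Y : topMeasurableType d2) (I J : countType)
    (B : I -> set X) (C : J -> set Y) :
  base B -> base C ->
  (forall O : set X, open O -> measurable O) ->
  (forall O : set Y, open O -> measurable O) ->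
  forall O : set (X * Y), open O -> measurable O.
Proof.
move=> bB bC mX mY O oO; rewrite (base_bigcup (base_prod bB bC) oO).
rewrite bigcup_mkcond; apply: countable_bigcupT_measurable => [|[i j]] /=.
  exact: countableP.
case: ifPn => // _; apply: measurableX; [apply/mX/bB.1|apply/mY/bC.1].
Qed.

Lemma within_continuous_measurable d (X : topMeasurableType d) d'
    (Y : topMeasurableType d') (D : set X) (f : X -> Y) :
  (forall O : set X, open O -> measurable O) -> borel_sigma Y ->
  measurable D -> {within D, continuous f} -> measurable_fun D f.
Proof.
move=> mX bY mD /continuousP cf;
apply: (measurability [set U : set Y | open U]).
  by apply/seteqP; split => A /bY.
move=> _ [U oU <-].
have /open_subspaceP[V oV VU] := cf _ oU.
by rewrite setIC -VU; apply: measurableI => //; exact: mX.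
Qed.

Lemma continuous_measurable_real d (X : topMeasurableType d) (R : realType)
    (f : X -> R) :
  (forall O : set X, open O -> measurable O) -> continuous f ->
  measurable_fun setT f.
Proof.
move=> mX /continuousP cf; apply: (measurability _ (RGenOpens.measurableE R)).
move=> _ [_ [a [b ->] <-]]; rewrite setTI.
by apply: mX; apply: cf; exact: interval_open.
Qed.

(** * Integrals depending on a parameter *)

Section ParametrizedIntegral.
Context (R : realType) d (X : topMeasurableType d).
Hypothesis lcX : locally_compact [set: X].
Hypothesis hX : hausdorff_space X.
Hypothesis mX : forall O : set X, open O -> measurable O.
Variables (lam : X -> {measure set X -> \bar R}) (r : X -> X).

(** The continuity axiom of a Haar system composed with [r], so that the parameter ranges over all
    of [X] and no subspace topology is left. *)
Definition continuous_measures := forall f : X -> R, continuous f ->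
  (forall x, 0 <= f x) ->
  (exists2 K, compact K & forall x, ~ K x -> f x = 0) ->
  (forall u, (\int[lam (r u)]_x (f x)%:E)%E \is a fin_num) /\
  continuous (fun u => fine (\int[lam (r u)]_x (f x)%:E)%E).

Hypothesis clam : continuous_measures.

Variables (Z : topologicalType) (F : X * Z -> R) (K : set X).
Hypothesis cF : continuous F.
Hypothesis F0 : forall p, 0 <= F p.
Hypothesis cK : compact K.
Hypothesis FK : forall x z, ~ K x -> F (x, z) = 0.

Let cFz z : continuous (fun x => F (x, z)).
Proof.
move=> x; apply: (@continuous_comp _ _ _ (fun x => (x, z)) F); last exact: cF.
exact: (continuous_pair (@id_continuous X) (@cst_continuous _ _ z)).
Qed.

Lemma param_integral_fin_num u z :
  (\int[lam (r u)]_x (F (x, z))%:E)%E \is a fin_num.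
Proof.
have [] := clam (@cFz z) (fun x => F0 (x, z))
  (ex_intro2 _ _ K cK (fun x => @FK x z)).
by move=> + _; exact.
Qed.

(** On [K] the joint continuity of [F] is made uniform in [x] by compactness (tube lemma); off [K]
    both values of [F] vanish. *)
Let near_section (phi : X -> R) (e : R) z0 : 0 < e ->
  (forall x, 0 <= phi x) -> (forall x, K x -> phi x = 1) ->
  \forall z \near z0, forall x, `|F (x, z) - F (x, z0)| <= e * phi x.
Proof.
move=> e0 phi0 phi1.
have /compact_near_coveringP := cK.
move=> /(_ Z (nbhs z0) (fun z x => `|F (x, z) - F (x, z0)| <= e) _) nK.
have {}nK : \forall z \near z0, K `<=` [set x | `|F (x, z) - F (x, z0)| <= e].
  apply: nK => x Kx.
  have e20 : 0 < e / 2 by rewrite divr_gt0.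
  have /cvgrPdist_lt/(_ _ e20)[[A B] [/= Ax Bz] AB] := @cF (x, z0).
  exists (A, B) => //= -[y z] [/= Ay Bz']; rewrite (splitr e).
  have -> : F (y, z) - F (y, z0) =
    (F (x, z0) - F (y, z0)) - (F (x, z0) - F (y, z)).
    by rewrite opprD addrACA subrr add0r opprK addrC.
  rewrite (le_trans (ler_normB _ _))// lerD// ltW//.
    by apply: (AB (y, z0)); split => //; exact: nbhs_singleton.
  by apply: (AB (y, z)).
apply: filterS nK => z zK x; have [Kx|nKx] := pselect (K x).
  by rewrite phi1// mulr1; exact: zK.
by rewrite !FK// subrr normr0 mulr_ge0// ltW.
Qed.

Let integral_close (phi : X -> R) (e : R) a b u : 0 <= e ->
  continuous phi -> (forall x, 0 <= phi x) ->
  (\int[lam (r u)]_x (phi x)%:E)%E \is a fin_num ->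
  (forall x, `|F (x, a) - F (x, b)| <= e * phi x) ->
  `|fine (\int[lam (r u)]_x (F (x, a))%:E)%E -
    fine (\int[lam (r u)]_x (F (x, b))%:E)%E| <=
  e * fine (\int[lam (r u)]_x (phi x)%:E)%E.
Proof.
move=> e0 cphi phi0 fphi Fab.
(* A one-sided bound, used in both directions: it compares integrals of nonnegative functions only,
   and no integral of a difference is formed. *)
have main a' b' : (forall x, F (x, a') <= F (x, b') + e * phi x) ->
    fine (\int[lam (r u)]_x (F (x, a'))%:E)%E <=
    fine (\int[lam (r u)]_x (F (x, b'))%:E)%E +
    e * fine (\int[lam (r u)]_x (phi x)%:E)%E.
  move=> h; rewrite -lee_fin EFinD EFinM !fineK//;
    try exact: param_integral_fin_num.
  have mphi := continuous_measurable_real mX cphi.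
  have mF z := continuous_measurable_real mX (@cFz z).
  rewrite -ge0_integralZl_EFin//; last 2 first.
  - by move=> x _; rewrite lee_fin.
  - exact/measurable_EFinP.
  rewrite -ge0_integralD//; last 4 first.
  - by move=> x _; rewrite lee_fin.
  - exact/measurable_EFinP.
  - by move=> x _; rewrite -EFinM lee_fin mulr_ge0.
  - by apply: measurable_funeM; exact/measurable_EFinP.
  apply: ge0_le_integral => //.
  - by move=> x _; rewrite lee_fin.
  - exact/measurable_EFinP.
  - apply: emeasurable_funD; first exact/measurable_EFinP.
    by apply: measurable_funeM; exact/measurable_EFinP.
  - by move=> x _; rewrite -EFinM -EFinD lee_fin.
rewrite ler_norml; apply/andP; split.
  rewrite lerNl opprB lerBlDl; apply: main => x.
  by rewrite -lerBlDl (le_trans _ (Fab x))// distrC ler_norm.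
rewrite lerBlDl; apply: main => x.
by rewrite -lerBlDl (le_trans _ (Fab x))// ler_norm.
Qed.

Lemma param_integral_continuous : continuous
  (fun p : X * Z => fine (\int[lam (r p.1)]_x (F (x, p.2))%:E)%E).
Proof.
move=> [u0 z0].
have [phi [W [cphi phi0 phi1 cW phiW]]] := compact_bump R lcX hX cK.
have [fphi cJ] := clam cphi phi0 (ex_intro2 _ _ W cW phiW).
have [_ cFz0] := clam (@cFz z0) (fun x => F0 (x, z0))
  (ex_intro2 _ _ K cK (fun x => @FK x z0)).
pose J u := fine (\int[lam (r u)]_x (phi x)%:E)%E.
have J0 u : 0 <= J u by apply/fine_ge0/integral_ge0 => x _; rewrite lee_fin.
have D0 : 0 < J u0 + 1 by rewrite ltr_pwDr.
apply/cvgrPdist_le => e e0.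
have e20 : 0 < e / 2 by rewrite divr_gt0.
(* Near [u0] one has [J u <= J u0 + 1], hence [e' * J u <= e / 2]. *)
pose e' := e / 2 / (J u0 + 1).
have e'0 : 0 < e' by rewrite divr_gt0.
have nz := near_section z0 e'0 phi0 phi1.
have /cvgrPdist_le/(_ _ e20) nu := cFz0 u0.
have /cvgrPdist_le/(_ _ ltr01) nJ := cJ u0.
(* The first factor controls [J u] and the change of [u] with [z0] frozen; the second controls the
   change from [z0] to [z] for all [x] at once. *)
exists ([set u | `|J u0 - J u| <= 1 /\
    `|fine (\int[lam (r u0)]_x (F (x, z0))%:E)%E -
      fine (\int[lam (r u)]_x (F (x, z0))%:E)%E| <= e / 2],
  [set z | forall x, `|F (x, z) - F (x, z0)| <= e' * phi x]).
  by split => //=; apply: filterI.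
move=> [u z] [/= [uJ uF] zF].
rewrite (splitr e).
rewrite (le_trans (ler_distD (fine (\int[lam (r u)]_x (F (x, z0))%:E)%E) _ _))//.
rewrite lerD// distrC.
rewrite (le_trans (integral_close (ltW e'0) cphi phi0 (fphi u) zF))//.
rewrite /e' mulrAC ler_pdivrMr// ler_pM2l//.
by rewrite -lerBlDl (le_trans _ uJ)// distrC ler_norm.
Qed.

End ParametrizedIntegral.

(** * Groupoids and Haar systems *)

Lemma measureI_conull d (X : measurableType d) (R : realType)
    (mu : {measure set X -> \bar R}) (A C : set X) :
  measurable A -> measurable C -> mu (~` C) = 0%E -> mu (A `&` C) = mu A.
Proof.
move=> mA mC C0.
have AC0 : mu (A `\` C) = 0%E; last first.
  by rewrite -[LHS]add0e -AC0; exact/esym/measureDI.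
apply: (subset_measure0 (B := ~` C)) => //; first exact: measurableD.
exact: measurableC.
Qed.

(** The members of the base that have finite measure already cover [X]; the others are replaced by
    the empty set. *)
Lemma locally_finite_sigma_finite d (X : topMeasurableType d) (R : realType)
    (mu : {measure set X -> \bar R}) (B : nat -> set X) :
  (forall O : set X, open O -> measurable O) -> base B ->
  (forall x : X, exists2 U, nbhs x U &
    (forall O : set X, open O -> O `<=` U -> mu O < +oo)%E) ->
  sigma_finite setT mu.
Proof.
move=> mX bB lf.
exists (fun n => if `[< (mu (B n) < +oo)%E >] then B n else set0).
  apply/esym; rewrite -subTset => x _.
  have [U Ux finU] := lf x; have [n Bx BU] := bB.2 x U Ux.
  by exists n => //; rewrite ifT//; apply/asboolP/finU => //; exact: bB.1.
move=> n; case: ifPn => [/asboolP fB|_]; last by rewrite measure0.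
by split => //; apply/mX/bB.1.
Qed.

(** * Left translation in a groupoid *)

Section Groupoid.
Context (X : Type) (GX : groupoid X).

Lemma gr_gunits u : gunits GX (gr GX u).
Proof. by exists u. Qed.

Lemma gunits_gr u : gunits GX u -> gr GX u = u.
Proof. by case=> x _ <-; rewrite (gr_unit GX x).1. Qed.

(* The identity off the fibre of [gr x], so as to be total. *)
Definition left_translate (x y : X) : X :=
  if `[< gr GX y = gr GX x >] then gmul GX (ginv GX x) y else y.

Lemma left_translateE x y : gr GX y = gr GX x ->
  left_translate x y = gmul GX (ginv GX x) y.
Proof. by move=> yx; rewrite /left_translate ifT//; apply/asboolP. Qed.

(** With [gmul_left_translate] below, this makes translation and left multiplication by [x] mutually
    inverse between the fibres of [gr x] and [gd x]; images under multiplication thus become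
    preimages. *)
Lemma left_translateK x y : gcomp GX x y ->
  left_translate x (gmul GX x y) = y.
Proof.
move=> xy; rewrite left_translateE ?gmul_r// -gmulA//; last first.
  by apply/gcompE; rewrite ginv_d.
by rewrite gmulVl (iffLR (gcompE _ _ _) xy) gmul_unitl.
Qed.

Lemma gr_left_translate x z : gr GX z = gr GX x ->
  gr GX (left_translate x z) = gd GX x.
Proof.
move=> zx; rewrite left_translateE// gmul_r ?ginv_r//.
by apply/gcompE; rewrite ginv_d.
Qed.

Lemma gmul_left_translate x z : gr GX z = gr GX x ->
  gmul GX x (left_translate x z) = z.
Proof.
move=> zx; rewrite left_translateE// -gmulA ?gmulV -?zx ?gmul_unitl//.
  by apply/gcompE; rewrite ginv_r.
by apply/gcompE; rewrite ginv_d.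
Qed.

End Groupoid.

Section GroupoidHom.
Context (X Y : Type) (GX : groupoid X) (GY : groupoid Y) (p : X -> Y).
Hypothesis pM : forall x y, gcomp GX x y ->
  gcomp GY (p x) (p y) /\ p (gmul GX x y) = gmul GY (p x) (p y).

(** The image of an idempotent is idempotent, and cancelling one factor by its inverse shows that it
    is a unit. *)
Let hom_idem e : gcomp GX e e -> gmul GX e e = e -> p e = gd GY (p e).
Proof.
move=> ee eE; have [pee] := pM ee; rewrite eE => peE.
rewrite -{1}(gmul_unitl GY (p e)) -(iffLR (gcompE _ _ _) pee) -gmulVl gmulA//.
  by rewrite -peE.
by apply/gcompE; rewrite ginv_d.
Qed.

(** Only multiplicativity of [p] is assumed. The image of [gr x] is idempotent, hence a unit, and
    its composability with [p x] tells which one. *)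
Lemma hom_gr x : p (gr GX x) = gr GY (p x).
Proof.
have c : gcomp GX (gr GX x) x by apply/gcompE; rewrite (gr_unit GX x).2.
rewrite -(iffLR (gcompE _ _ _) (pM c).1); apply: hom_idem.
  by apply/gcompE; rewrite (gr_unit GX x).1 (gr_unit GX x).2.
by rewrite -{1}(gr_unit GX x).1 gmul_unitl.
Qed.

End GroupoidHom.

(** * Topology and fibre measures of a Haar groupoid *)

Section HaarGroupoid.
Context (R : realType) d (X : topMeasurableType d) (GX : groupoid X)
  (lam : X -> {measure set X -> \bar R}) (mu : {measure set X -> \bar R}).
Hypothesis HG : haar_groupoid GX lam mu.

Lemma haar_hausdorff : hausdorff_space X.
Proof. by case: HG => -[]. Qed.

Lemma haar_locally_compact : locally_compact [set: X].
Proof. by case: HG => -[]. Qed.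

Lemma haar_base : exists B : nat -> set X, base B.
Proof. by case: HG => -[_ /second_countable_base]. Qed.

Lemma haar_borel : borel_sigma X.
Proof. by case: HG => -[]. Qed.

Lemma haar_open_measurable (O : set X) : open O -> measurable O.
Proof. by move=> oO; apply/haar_borel; exact: sub_sigma_algebra. Qed.

Lemma haar_closed_measurable (C : set X) : closed C -> measurable C.
Proof.
move=> cC; rewrite -(setCK C); apply: measurableC.
exact/haar_open_measurable/closed_openC.
Qed.

(** [gr x] is the product of [x] and its inverse, a pair that is always composable, so continuity
    within the composable pairs suffices. *)
Lemma gr_continuous : continuous (gr GX).
Proof.
have [cm ci] : topological_groupoid GX by case: HG => -[].
have := continuous_within_comp cm (continuous_pair (@id_continuous X) ci).
rewrite (_ : _ @^-1` _ = setT); last first.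
  by apply/seteqP; split => // x _ /=; apply/gcompE; rewrite ginv_r.
rewrite -continuous_subspace_setT.
by rewrite (_ : _ \o _ = gr GX)//; apply/funext => x /=; exact: gmulV.
Qed.

Lemma gd_continuous : continuous (gd GX).
Proof.
have [_ ci] : topological_groupoid GX by case: HG => -[].
rewrite (_ : gd GX = fun x => gr GX (ginv GX x)); last first.
  by apply/funext => x; rewrite ginv_r.
exact: continuousT_comp ci gr_continuous.
Qed.

Lemma haar_fiber_null u :
  gunits GX u -> lam u (~` [set x | gr GX x = u]) = 0%E.
Proof.
move=> Uu; have [_ [[/(_ u Uu)[_ <-] _] _]] := HG.
by congr (lam u (~` _)); apply/seteqP; split => x //= [].
Qed.

Lemma closed_fiber u : closed [set x | gr GX x = u].
Proof.
apply: (closed_equalizer haar_hausdorff gr_continuous).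
by move=> x; exact: cvg_cst.
Qed.

Lemma haar_continuous_measures : continuous_measures lam (gr GX).
Proof.
move=> f cf f0 [K cK fK].
have [_ [[_ [/(_ f) + _]] _]] := HG.
case=> //.
- exact: continuous_subspaceT.
- by exists K; split => // x _; exact: fK.
move=> fin cu; split => [u|]; first by apply: fin; exact: gr_gunits.
have := continuous_within_comp cu gr_continuous.
rewrite (_ : _ @^-1` _ = setT); last by apply/seteqP; split => // x _; exists x.
by rewrite -continuous_subspace_setT.
Qed.

Lemma haar_open_gt0 (O : set X) x : open O -> O x -> (0 < lam (gr GX x) O)%E.
Proof.
move=> oO Ox; have [_ [[_ [_ [_ pos]]] _]] := HG.
by rewrite -(setIT O); apply: pos => //; [exact: gr_gunits|exists x].
Qed.

(** A bump [phi] at [x] has finite integral, and Markov's inequality bounds the measure of every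
    open set on which [phi > 1/2]; so the measure is locally finite. *)
Lemma haar_sigma_finite u : sigma_finite setT (lam (gr GX u)).
Proof.
have [B bB] := haar_base.
apply: (locally_finite_sigma_finite haar_open_measurable bB) => x.
have [phi [W [cphi phi0 phi1 cW phiW]]] :=
  compact_bump R haar_locally_compact haar_hausdorff (@compact_set1 X x).
have [fphi _] := haar_continuous_measures cphi phi0 (ex_intro2 _ _ W cW phiW).
exists [set y | 2^-1 < phi y].
  apply: (cphi x [set z | 2^-1 < z]); apply: open_nbhs_nbhs; split.
    exact: open_gt.
  by rewrite /= phi1// invf_lt1// ltr1n.
move=> O oO Ophi; have mO := haar_open_measurable oO.
have mphi := continuous_measurable_real haar_open_measurable cphi.
have mI : measurable_fun setT (EFin \o (\1_O : X -> R)).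
  exact/measurable_EFinP/measurable_indic.
have : (2^-1%:E * lam (gr GX u) O <= \int[lam (gr GX u)]_x (phi x)%:E)%E.
  rewrite -[X in lam _ X]setIT -integral_indic// -ge0_integralZl_EFin//.
  apply: ge0_le_integral => //.
  - exact: measurable_funeM.
  - exact/measurable_EFinP.
  move=> y _; rewrite -EFinM lee_fin indicE; case: (boolP (y \in O)) => [|_].
    by rewrite inE mulr1 => /Ophi/ltW.
  by rewrite mulr0.
move=> /le_lt_trans h; have {}h : (2^-1%:E * lam (gr GX u) O < +oo)%E.
  by apply: h; rewrite ltey_eq fphi.
rewrite ltNge leye_eq; apply/negP => /eqP Oy.
by move: h; rewrite Oy gt0_muley// lte_fin invr_gt0.
Qed.

(** Cut along the closed fibre of [gr x]: on it the map is multiplication by the inverse of [x],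
    continuous there; off it, the identity. *)
Lemma measurable_left_translate x : measurable_fun setT (left_translate GX x).
Proof.
have mA := haar_closed_measurable (@closed_fiber (gr GX x)).
rewrite -(setUv [set y | gr GX y = gr GX x]).
apply/measurable_funU => //; first exact: measurableC.
split; last first.
  apply: (eq_measurable_fun id) => // y /set_mem /= yx.
  by rewrite /left_translate ifF//; apply/asboolP.
apply: (eq_measurable_fun (gmul GX (ginv GX x))) => //.
  by move=> y /set_mem /= yx; rewrite left_translateE.
apply: within_continuous_measurable => //; [exact: haar_open_measurable|
  exact: haar_borel|].
have [cm ci] : topological_groupoid GX by case: HG => -[].
have := continuous_within_comp cm
  (continuous_pair (@cst_continuous _ _ (ginv GX x)) (@id_continuous X)).
rewrite (_ : _ @^-1` _ = [set y | gr GX y = gr GX x])//.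
by apply/seteqP; split => y /=; rewrite gcompE ginv_d.
Qed.

(** Invariance in pushforward form: the translated set of the axiom is the trace of the preimage on
    the fibre of [gr x], whose complement is null. *)
Lemma haar_left_invariant x E : measurable E ->
  lam (gd GX x) E = lam (gr GX x) (left_translate GX x @^-1` E).
Proof.
move=> mE; have [_ [[_ [_ [inv _]]] _]] := HG.
rewrite inv//.
have mA := haar_closed_measurable (@closed_fiber (gr GX x)).
rewrite -[RHS](measureI_conull _ mA) ?haar_fiber_null//; last 2 first.
- rewrite -(setTI (_ @^-1` _)); exact: measurable_left_translate.
- exact: gr_gunits.
congr (lam _ _); apply/seteqP; split => [_ [y [Ey [_ yx]] <-]|z [/= Ez zx]].
  have xy : gcomp GX x y by apply/gcompE.
  by split => /=; [rewrite left_translateK|rewrite gmul_r].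
exists (left_translate GX x z); last exact: gmul_left_translate.
by split => //; split => //; exact: gr_left_translate.
Qed.

End HaarGroupoid.

(** * Products with a Dirac mass *)

Section SigmaFiniteCopy.
Context d (X : measurableType d) (R : realType).
Variable mu : {measure set X -> \bar R}.
Hypothesis smu : sigma_finite setT mu.

(** An alias of [mu] that carries the proof of sigma-finiteness, so that the structure can be
    attached to it. *)
Definition sigma_finite_copy of sigma_finite setT mu : set X -> \bar R := mu.

HB.instance Definition _ := Measure.on (sigma_finite_copy smu).
HB.instance Definition _ :=
  Measure_isSigmaFinite.Build d X R (sigma_finite_copy smu) smu.

End SigmaFiniteCopy.

Lemma ge0_eq_integral_conull d (X : measurableType d) (R : realType)
    (mu : {measure set X -> \bar R}) (C : set X) (f g : X -> \bar R) :
  measurable C -> mu (~` C) = 0%E ->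
  measurable_fun setT f -> measurable_fun setT g ->
  (forall x, C x -> f x = g x) ->
  (\int[mu]_x f x = \int[mu]_x g x)%E.
Proof.
move=> mC C0 mf mg fg; apply: ae_eq_integral => //.
exists (~` C); split => //; first exact: measurableC.
by move=> x /= nfg Cx; apply: nfg => _; exact: fg.
Qed.

Section DiracSlice.
Context (R : realType) d1 d2 (S : measurableType d1) (G : measurableType d2).
Variables (m1 : {measure set S -> \bar R}) (g : G).

Lemma measurable_slice : measurable_fun setT (fun s : S => (s, g)).
Proof. by apply/measurable_fun_pair => //; exact: measurable_cst. Qed.

Lemma dirac_prodE (A : set (S * G)) : measurable A ->
  (m1 \x \d_g)%E A = pushforward m1 (fun s => (s, g)) A.
Proof.
move=> mA; rewrite /product_measure1 /pushforward.
transitivity (\int[m1]_s (\1_((fun s => (s, g)) @^-1` A) s)%:E)%E.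
  by apply: eq_integral => s _; rewrite /= diracE indicE mem_xsection.
rewrite integral_indic ?setIT//.
by rewrite -(setTI (_ @^-1` _)); exact: measurable_slice.
Qed.

Lemma dirac_prod_integral (f : S * G -> \bar R) :
  measurable_fun setT f -> (forall x, 0 <= f x)%E ->
  (\int[(m1 \x \d_g)]_x f x = \int[m1]_s f (s, g))%E.
Proof.
move=> mf f0.
rewrite (@eq_measure_integral _ _ _ _ (pushforward m1 (fun s => (s, g)))).
  by rewrite ge0_integral_pushforward// => x _.
by move=> A mA _; exact: dirac_prodE.
Qed.

Lemma dirac_prod_sigma_finite :
  sigma_finite setT m1 -> sigma_finite setT (m1 \x \d_g)%E.
Proof.
move=> [F TF mF]; exists (fun n => F n `*` setT).
  by rewrite -setX_bigcupl -TF setXTT.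
move=> n; have [mFn fFn] := mF n; split; first exact: measurableX.
rewrite dirac_prodE; last exact: measurableX.
rewrite /pushforward (_ : _ @^-1` _ = F n)//.
by apply/seteqP; split => s //= [].
Qed.

End DiracSlice.

Section SliceMeasure.
Context (R : realType) d1 d2 d3 (S : measurableType d1) (G : measurableType d2)
  (T : measurableType d3).
Variables (m1 : {measure set S -> \bar R}) (g : G)
  (m2 : {sigma_finite_measure set T -> \bar R}).

Lemma slice_measurable (A : set (S * G * T)) : measurable A ->
  measurable_fun setT (fun s => m2 [set t | A (s, g, t)]).
Proof.
move=> mA; have mx := measurable_fun_xsection m2 mA.
apply: (eq_measurable_fun ((m2 \o xsection A) \o (fun s => (s, g)))) => //.
  move=> s _ /=; congr (m2 _).
  by apply/seteqP; split => t; rewrite /xsection /= inE.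
by apply: measurableT_comp => //; exact: measurable_slice.
Qed.

Lemma slice_measureE (A : set (S * G * T)) : measurable A ->
  ((m1 \x \d_g) \x m2)%E A = (\int[m1]_s m2 [set t | A (s, g, t)])%E.
Proof.
move=> mA.
rewrite [LHS](@dirac_prod_integral _ _ _ _ _ m1 g (m2 \o xsection A))//.
  apply: eq_integral => s _ /=; congr (m2 _).
  by apply/seteqP; split => t; rewrite /xsection /= inE.
exact: measurable_fun_xsection.
Qed.

Lemma slice_measureX (A : set S) (B : set G) (C : set T) :
  measurable A -> measurable B -> measurable C -> B g ->
  ((m1 \x \d_g) \x m2)%E ((A `*` B) `*` C) = (m1 A * m2 C)%E.
Proof.
move=> mA mB mC Bg; have mAB := measurableX mA mB.
rewrite [LHS](@product_measure1E _ _ _ _ R (m1 \x \d_g)%E m2)//.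
congr (_ * _)%E.
have dB : \d_g B = 1%E :> \bar R by rewrite diracE mem_set.
by rewrite -[RHS]mule1 -dB; exact: (@product_measure1E _ _ _ _ R m1 \d_g).
Qed.

(** Tonelli for the outer product; the Dirac factor then evaluates the inner integral at [g]. *)
Lemma slice_integral (F : S * G * T -> \bar R) : sigma_finite setT m1 ->
  measurable_fun setT F -> (forall x, 0 <= F x)%E ->
  (\int[((m1 \x \d_g) \x m2)]_x F x = \int[m1]_s \int[m2]_t F (s, g, t))%E.
Proof.
move=> sm1 mF F0.
(* Canonical inference for [_ \x _] only finds the product of subprobabilities. *)
pose m12 : {sigma_finite_measure set (S * G)%type -> \bar R} :=
  sigma_finite_copy (dirac_prod_sigma_finite g sm1).
transitivity (\int[m12]_x fubini_F m2 F x)%E.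
  exact: (@fubini_tonelli1 _ _ _ _ _ m12 m2 F mF F0).
apply: (@dirac_prod_integral _ _ _ _ _ m1 g (fubini_F m2 F)).
  exact: measurable_fun_fubini_tonelli_F.
by move=> x; exact: integral_ge0.
Qed.

End SliceMeasure.

(** * The weak pullback *)

Section WeakPullbackHaar.
Context (R : realType) (dS dG dT : measure_display)
  (S : topMeasurableType dS) (G : topMeasurableType dG)
  (T : topMeasurableType dT)
  (GS : groupoid S) (lamS : S -> {measure set S -> \bar R})
  (muS : {measure set S -> \bar R})
  (GG : groupoid G) (lamG : G -> {measure set G -> \bar R})
  (muG : {measure set G -> \bar R})
  (GT : groupoid T) (lamT : T -> {measure set T -> \bar R})
  (muT : {measure set T -> \bar R})
  (p : S -> G) (q : T -> G).
Hypothesis HS : haar_groupoid GS lamS muS.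
Hypothesis HG : haar_groupoid GG lamG muG.
Hypothesis HT : haar_groupoid GT lamT muT.
Hypothesis Hp : haar_hom GS lamS muS GG lamG muG p.
Hypothesis Hq : haar_hom GT lamT muT GG lamG muG q.

Local Notation P := (wpb GG p q).
Local Notation P0 := (wpb_units GS GG GT p q).
Local Notation rP := (wpb_r GS GT).
Local Notation dP := (wpb_d GS GG GT p q).
Local Notation lamP := (wpb_lam lamS lamT).

(** * Topology and Borel structure of the weak pullback *)

Let fst1_continuous : continuous (fun x : S * G * T => x.1.1).
Proof. exact: continuousT_comp (@fst_continuous _ _) (@fst_continuous _ _). Qed.

Let snd1_continuous : continuous (fun x : S * G * T => x.1.2).
Proof. exact: continuousT_comp (@fst_continuous _ _) (@snd_continuous _ _). Qed.

Lemma wpb_closed : closed P.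
Proof.
have cr := gr_continuous HG; have cd := gd_continuous HG.
have hG := haar_hausdorff HG.
apply: closedI; apply: (closed_equalizer hG).
- exact: continuousT_comp snd1_continuous cr.
- apply: continuousT_comp cr; exact: continuousT_comp fst1_continuous Hp.1.
- exact: continuousT_comp snd1_continuous cd.
- apply: continuousT_comp cr.
  exact: continuousT_comp (@snd_continuous _ _) Hq.1.
Qed.

Lemma wpb_open_measurable (O : set (S * G * T)) : open O -> measurable O.
Proof.
have [BS bS] := haar_base HS; have [BG bG] := haar_base HG.
have [BT bT] := haar_base HT.
apply: (open_measurable_prod (base_prod bS bG) bT).
  apply: (open_measurable_prod bS bG).
    exact: haar_open_measurable HS.
  exact: haar_open_measurable HG.
exact: haar_open_measurable HT.
Qed.

Lemma wpb_closed_measurable (C : set (S * G * T)) : closed C -> measurable C.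
Proof.
move=> cC; rewrite -(setCK C); apply: measurableC.
by apply: wpb_open_measurable; exact: closed_openC.
Qed.

(** Over a unit, membership in [P] is automatic: [gr (p s) = p (gr s)] is the image of the first
    coordinate of [u], which is the range of the middle one; likewise for [q]. *)
Lemma wpb_fiberE u : P0 u -> [set x | P x /\ rP x = u] =
  [set x | [/\ gr GS x.1.1 = u.1.1, x.1.2 = u.1.2 & gr GT x.2 = u.2]].
Proof.
have [_ [pM _]] := Hp; have [_ [qM _]] := Hq.
case: u => [[s0 g0] t0] [/= us ut rg dg].
apply/seteqP; split => [[[s g] t] [_ [<- <- <-]]//|[[s g] t] [/= sE -> tE]].
split; last by rewrite /wpb_r /= sE tE.
by split => /=; rewrite ?rg ?dg -?(hom_gr pM) -?(hom_gr qM) ?sE ?tE.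
Qed.

Lemma wpb_fiber_measurable u : P0 u -> measurable [set x | P x /\ rP x = u].
Proof.
move=> Pu; rewrite wpb_fiberE//; apply: wpb_closed_measurable.
rewrite (_ : mkset _ = (fun x => x.1.1) @^-1` [set s | gr GS s = u.1.1] `&`
    (fun x => x.1.2) @^-1` [set u.1.2] `&`
    snd @^-1` [set t | gr GT t = u.2]); last first.
  by apply/seteqP; split => [x [? ? ?]|x [[? ?] ?]].
apply: closedI; [apply: closedI|].
- move/continuous_closedP : fst1_continuous; apply.
  exact: (closed_fiber HS).
- move/continuous_closedP : snd1_continuous; apply.
  apply: (@compact_closed _ _ (haar_hausdorff HG)); exact: compact_set1.
- move/continuous_closedP : (@snd_continuous (S * G)%type T); apply.
  exact: (closed_fiber HT).
Qed.

(** A unit of [T] is its own range, so its fibre measure is sigma-finite. Packing that fact into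
    [nu] leaves the function unchanged and opens [lamP u] to the slice lemmas. *)
Lemma wpb_lam_packed u : P0 u ->
  exists nu : {sigma_finite_measure set T -> \bar R},
    (nu : set T -> \bar R) = lamT u.2 /\
    lamP u = ((lamS u.1.1 \x \d_(u.1.2)) \x nu)%E.
Proof.
case=> _ ut _ _; have := haar_sigma_finite HT u.2.
by rewrite (gunits_gr ut) => sT; exists (sigma_finite_copy sT).
Qed.

(** For almost every [s], namely on the fibre in [S], the slice of the complement is the complement
    of the fibre in [T], a null set. *)
Lemma wpb_lam_null u : P0 u -> lamP u (~` [set x | P x /\ rP x = u]) = 0%E.
Proof.
move=> Pu; have [us ut _ _] := Pu; have [nu [nuE ->]] := wpb_lam_packed Pu.
have mN := measurableC (wpb_fiber_measurable Pu).
rewrite slice_measureE//.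
rewrite (@ge0_eq_integral_conull _ _ _ _ [set s | gr GS s = u.1.1] _ (cst 0%E)).
- by rewrite integral0.
- exact/(haar_closed_measurable HS)/(closed_fiber HS).
- exact: haar_fiber_null HS _ us.
- exact: slice_measurable.
- exact: measurable_cst.
move=> s sE; rewrite wpb_fiberE// nuE /=.
rewrite -(haar_fiber_null HT ut); congr (lamT _ _).
apply/seteqP; split => t /=; first by move=> h tE; apply: h; split.
by move=> h [].
Qed.

Lemma wpb_lam_measure u : P0 u ->
  exists m : {measure set (S * G * T)%type -> \bar R},
    (m : set (S * G * T) -> \bar R) = lamP u.
Proof.
move=> Pu; have [nu [_ ->]] := wpb_lam_packed Pu.
by exists ((lamS u.1.1 \x \d_(u.1.2)) \x nu)%E.
Qed.

Lemma wpb_lam_is_measure u : P0 u -> is_measure (lamP u).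
Proof.
move=> Pu; have [m <-] := wpb_lam_measure Pu.
split; first exact: measure0.
by split; [move=> A _; exact: measure_ge0|exact: measure_semi_sigma_additive].
Qed.

Lemma wpb_lam_conull u : P0 u -> lamP u (~` P) = 0%E.
Proof.
move=> Pu; have := wpb_lam_null Pu.
have mf := wpb_fiber_measurable Pu; have mP := wpb_closed_measurable wpb_closed.
have [m <-] := wpb_lam_measure Pu => m0.
apply: (subset_measure0 (B := ~` [set x | P x /\ rP x = u])) => //.
- exact: measurableC.
- exact: measurableC.
- by move=> x /= nP [].
Qed.

(** An open box inside [O] around the given point has as mass the product of two positive masses,
    its middle side containing the Dirac point; cutting by the conull set [P] loses nothing. *)
Lemma wpb_lam_open_gt0 u (O : set (S * G * T)) : P0 u -> open O ->
  (exists x, [/\ O x, P x & rP x = u]) -> (0 < lamP u (O `&` P))%E.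
Proof.
move=> Pu oO [[[s g] t] [Ox Px rx]].
have sE : gr GS s = u.1.1 by rewrite -rx.
have gE : g = u.1.2 by rewrite -rx.
have tE : gr GT t = u.2 by rewrite -rx.
have [[V C] [/= [[A B] [/= As Bg] ABV] Ct] VCO] : nbhs (s, g, t) O.
  exact: open_nbhs_nbhs.
move: As Bg Ct; rewrite !nbhsE.
move=> -[A' [oA As] AA] [B' [oB Bg] BB] [C' [oC Ct] CC].
have ABC : (A' `*` B') `*` C' `<=` O.
  move=> [[a b] c] [[/= /AA Aa /BB Bb] /CC Cc]; apply: VCO; split => //=.
  exact: ABV.
have mA := haar_open_measurable HS oA; have mB := haar_open_measurable HG oB.
have mC := haar_open_measurable HT oC.
have mABC : measurable ((A' `*` B') `*` C').
  by apply: measurableX => //; exact: measurableX.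
have mP := wpb_closed_measurable wpb_closed.
have : (0 < lamP u ((A' `*` B') `*` C'))%E.
  have [nu [nuE ->]] := wpb_lam_packed Pu.
  rewrite slice_measureX -?gE// mule_gt0//.
    by rewrite -sE; exact: haar_open_gt0 HS _ _ oA As.
  by rewrite nuE -tE; exact: haar_open_gt0 HT _ _ oC Ct.
have := wpb_lam_conull Pu.
have [m <-] := wpb_lam_measure Pu => m0; rewrite -(measureI_conull mABC mP m0).
move=> /lt_le_trans; apply; apply: le_measure; rewrite ?inE.
- exact: measurableI.
- by apply: measurableI => //; exact: wpb_open_measurable.
- by apply: setSI.
Qed.

Lemma wpb_lam_left_invariant x (E : set (S * G * T)) : measurable E ->
  E `<=` P ->
  lamP (dP x) E =
  lamP (rP x)
    [set wpb_mul GS GT x y | y in [set y | E y /\ P y /\ rP y = dP x]].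
Proof.
case: x => [[s g] t] mE EP; set M := (X in _ = lamP _ X).
set g' := gmul GG (gmul GG (ginv GG (p s)) g) (q t).
pose ts := left_translate GS s; pose tt := left_translate GT t.
have mts : measurable_fun setT ts := measurable_left_translate HS s.
have mtt : measurable_fun setT tt := measurable_left_translate HT t.
(* The translated set rewritten as a preimage, which gives its measurability; translating back sends
   the middle coordinate [g] to [g']. *)
have ME : M = [set z | [/\ gr GS z.1.1 = gr GS s, z.1.2 = g,
    gr GT z.2 = gr GT t & E (ts z.1.1, g', tt z.2)]].
  apply/seteqP; split.
    move=> _ [[[a b] c] [Ey [_ [aE bE cE]]] <-] /=.
    have sa : gcomp GS s a by apply/gcompE.
    have tc : gcomp GT t c by apply/gcompE.
    rewrite /ts /tt !gmul_r// !left_translateK//; split => //.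
    by rewrite /g' -bE.
  move=> [[a b] c] [/= aE -> cE Ez].
  exists (ts a, g', tt c).
    split => //; split; first exact: EP.
    by rewrite /wpb_r /= /ts /tt !gr_left_translate.
  by rewrite /wpb_mul /= /ts /tt !gmul_left_translate.
have mtr : measurable_fun setT
    (fun z : S * G * T => (ts z.1.1, g', tt z.2)).
  apply/measurable_fun_pair => /=; last exact: measurableT_comp.
  apply/measurable_fun_pair => /=; last exact: measurable_cst.
  apply: measurableT_comp => //.
  by apply: (@measurableT_comp _ _ _ _ _ _ fst) => //.
have mM : measurable M.
  rewrite ME (_ : mkset _ =
    (((fun z => gr GS z.1.1) @^-1` [set gr GS s] `&`
      (fun z => z.1.2) @^-1` [set g])
    `&` (fun z => gr GT z.2) @^-1` [set gr GT t]) `&`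
    (fun z => (ts z.1.1, g', tt z.2)) @^-1` E); last first.
    by apply/seteqP; split => [z [? ? ? ?]|z [[[? ?] ?] ?]].
  apply: measurableI; last by rewrite -(setTI (_ @^-1` _)); exact: mtr.
  apply: wpb_closed_measurable; apply: closedI; first apply: closedI.
  - apply: (closed_equalizer (haar_hausdorff HS)); last exact: cst_continuous.
    exact: continuousT_comp fst1_continuous (gr_continuous HS).
  - apply: (closed_equalizer (haar_hausdorff HG)); last exact: cst_continuous.
    exact: snd1_continuous.
  - apply: (closed_equalizer (haar_hausdorff HT)); last exact: cst_continuous.
    exact: continuousT_comp (@snd_continuous _ _) (gr_continuous HT).
have sd := haar_sigma_finite HT (gd GT t); rewrite (gd_unit GT t).1 in sd.
pose nud : {sigma_finite_measure set T -> \bar R} := sigma_finite_copy sd.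
pose nur : {sigma_finite_measure set T -> \bar R} :=
  sigma_finite_copy (haar_sigma_finite HT t).
have mE2 a : measurable [set b | E (a, g', b)].
  rewrite (_ : mkset _ = (fun b => (a, g', b)) @^-1` E)// -(setTI (_ @^-1` _)).
  have mab : measurable_fun setT (fun b : T => (a, g', b)).
    by apply/measurable_fun_pair => //=; exact: measurable_cst.
  exact: mab.
have mtt3 : measurable_fun setT (fun z : S * G * T => (z.1, tt z.2)).
  by apply/measurable_fun_pair => //=; exact: measurableT_comp.
have mEtt : measurable [set z : S * G * T | E (z.1, tt z.2)].
  rewrite (_ : mkset _ = (fun z => (z.1, tt z.2)) @^-1` E)//.
  by rewrite -(setTI (_ @^-1` _)); exact: mtt3.
have mEtr : measurable [set z : S * G * T | E (ts z.1.1, g', tt z.2)].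
  rewrite (_ : mkset _ = (fun z => (ts z.1.1, g', tt z.2)) @^-1` E)//.
  by rewrite -(setTI (_ @^-1` _)); exact: mtr.
(* Slice at [g'] and use invariance in [T] on each slice. *)
transitivity (\int[lamS (gd GS s)]_a
    lamT (gr GT t) (tt @^-1` [set b | E (a, g', b)]))%E.
  transitivity (((lamS (gd GS s) \x \d_g') \x nud)%E E); first by [].
  rewrite slice_measureE//; apply: eq_integral => a _.
  exact: (haar_left_invariant HT t (mE2 a)).
(* Invariance in [S] is the change of variables along [ts] in the outer integral. *)
transitivity (\int[lamS (gr GS s)]_a
    lamT (gr GT t) (tt @^-1` [set b | E (ts a, g', b)]))%E.
  rewrite (@eq_measure_integral _ _ _ _ (pushforward (lamS (gr GS s)) ts)).
    rewrite ge0_integral_pushforward//.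
    exact: (slice_measurable g' nur mEtt).
  by move=> A mA _; exact: (haar_left_invariant HS s mA).
transitivity (((lamS (gr GS s) \x \d_g) \x nur)%E M); last by [].
rewrite slice_measureE//.
(* For [a] in this conull fibre, the slice of [M] at [g] is the preimage under [tt] cut by the fibre
   in [T], again conull. *)
apply: (@ge0_eq_integral_conull _ _ _ _ [set a | gr GS a = gr GS s]).
- exact/(haar_closed_measurable HS)/(closed_fiber HS).
- exact: haar_fiber_null HS _ (gr_gunits GS s).
- exact: (slice_measurable g nur mEtr).
- exact: (slice_measurable g nur mM).
move=> a aE.
have mC := haar_closed_measurable HT (closed_fiber HT (u := gr GT t)).
have C0 := haar_fiber_null HT (gr_gunits GT t).
have mA : measurable (tt @^-1` [set b | E (ts a, g', b)]).
  by rewrite -(setTI (_ @^-1` _)); exact: mtt.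
rewrite -(measureI_conull mA mC C0).
transitivity (lamT (gr GT t) [set b | M (a, g, b)]); last by [].
congr (lamT _ _); rewrite ME.
by apply/seteqP; split => [b [? ?]|b [? ? ? ?]].
Qed.

Lemma wpb_lam_continuous (f : S * G * T -> R) :
  {within P, continuous f} -> (forall x, P x -> 0 <= f x) ->
  (exists K : set (S * G * T), [/\ compact K, K `<=` P &
    forall x, P x -> ~ K x -> f x = 0]) ->
  (forall u, P0 u -> (\int[lamP u]_(x in P) (f x)%:E)%E \is a fin_num) /\
  {within P0, continuous (fun u => fine (\int[lamP u]_(x in P) (f x)%:E)%E)}.
Proof.
move=> cf f0 [K [cK KP fK]].
have lcSG :=
  locally_compact_prod (haar_locally_compact HS) (haar_locally_compact HG).
have lcX := locally_compact_prod lcSG (haar_locally_compact HT).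
have hSG := hausdorff_prod (haar_hausdorff HS) (haar_hausdorff HG).
have hX := hausdorff_prod hSG (haar_hausdorff HT).
have [F [W [cF F0 Ff cW FW]]] :=
  compact_support_extension lcX hX wpb_closed cf f0 cK fK.
(* The coordinates are swapped because the parametrized integral is taken over the first factor. *)
have cFT : continuous (fun y : T * (S * G) => F (y.2, y.1)).
  apply: continuousT_comp cF.
  exact: continuous_pair (@snd_continuous _ _) (@fst_continuous _ _).
have cKT : compact (snd @` W).
  by apply: continuous_compact cW; exact/continuous_subspaceT/snd_continuous.
have FKT t z : ~ (snd @` W) t -> F (z, t) = 0.
  by move=> nt; apply: FW => Wzt; apply: nt; exists (z, t).
have clamT := haar_continuous_measures HT.
have cHT := param_integral_continuous (haar_locally_compact HT)
  (haar_hausdorff HT) (haar_open_measurable HT) clamT cFT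
  (fun y => F0 (y.2, y.1)) cKT FKT.
(* The inner integral over [T], with [s] put first to be integrated next and the middle and last
   coordinates of the unit as parameters. *)
pose FS (y : S * (G * T)) :=
  fine (\int[lamT (gr GT y.2.2)]_t (F (y.1, y.2.1, t))%:E)%E.
have cFS : continuous FS.
  have cr : continuous (fun y : S * (G * T) => (y.2.2, (y.1, y.2.1))).
    apply: continuous_pair; last apply: continuous_pair.
    - exact: continuousT_comp (@snd_continuous _ _) (@snd_continuous _ _).
    - exact: fst_continuous.
    - exact: continuousT_comp (@snd_continuous _ _) (@fst_continuous _ _).
  exact: continuousT_comp cr cHT.
have FS0 y : 0 <= FS y.
  by apply/fine_ge0/integral_ge0 => t _; rewrite lee_fin.
have cKS : compact ((fun x => x.1.1) @` W).
  by apply: continuous_compact cW; exact/continuous_subspaceT/fst1_continuous.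
have FKS s z : ~ ((fun x => x.1.1) @` W) s -> FS (s, z) = 0.
  move=> ns; rewrite /FS integral0_eq// => t _; rewrite FW// => Wst.
  by apply: ns; exists (s, z.1, t).
have clamS := haar_continuous_measures HS.
have fHS := param_integral_fin_num clamS cFS FS0 cKS FKS.
have cHS := param_integral_continuous (haar_locally_compact HS)
  (haar_hausdorff HS) (haar_open_measurable HS) clamS cFS FS0 cKS FKS.
have mF := continuous_measurable_real wpb_open_measurable cF.
have mEF : measurable_fun setT (EFin \o F) by exact/measurable_EFinP.
(* [F] replaces [f] because [P] is conull; at a unit the range maps inside [FS] and the outer
   integral act as the identity. *)
have key u : P0 u -> (\int[lamP u]_(x in P) (f x)%:E =
    \int[lamS (gr GS u.1.1)]_s (FS (s, (u.1.2, u.2)))%:E)%E.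
  move=> Pu; have [us ut _ _] := Pu.
  transitivity (\int[lamP u]_x (F x)%:E)%E.
    have mP := wpb_closed_measurable wpb_closed.
    have := wpb_lam_conull Pu; have [m <-] := wpb_lam_measure Pu => m0.
    rewrite integral_mkcond.
    have -> : (EFin \o f) \_ P = (EFin \o F) \_ P.
      apply/funext => x; rewrite !patchE; case: ifPn => // /set_mem Px /=.
      by rewrite Ff.
    apply: (ge0_eq_integral_conull mP m0) => //.
      by apply/(measurable_restrictT _ mP); exact: measurable_funTS.
    by move=> x Px; rewrite patchE mem_set.
  have [nu [nuE ->]] := wpb_lam_packed Pu.
  have sS := haar_sigma_finite HS u.1.1; rewrite (gunits_gr us) in sS.
  rewrite slice_integral// ?(gunits_gr us)//.
  apply: eq_integral => s _; rewrite /FS /= nuE fineK ?(gunits_gr ut)//.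
  rewrite -{1}(gunits_gr ut).
  exact: (param_integral_fin_num clamT cFT (fun y => F0 (y.2, y.1)) cKT FKT).
split => [u Pu|]; first by rewrite key.
have cre : continuous (fun u : S * G * T => (u.1.1, (u.1.2, u.2))).
  apply: continuous_pair; first exact: fst1_continuous.
  by apply: continuous_pair; [exact: snd1_continuous|exact: snd_continuous].
(* The iterated integral is continuous on all of [S * G * T], and agrees with the integral of [f] on
   [P0]. *)
apply: (@subspace_eq_continuous _ P0 _
  (fun u => fine (\int[lamS (gr GS u.1.1)]_s (FS (s, (u.1.2, u.2)))%:E)%E)).
  by move=> u /set_mem Pu; congr fine; exact/esym/key.
apply: continuous_subspaceT; exact: continuousT_comp cre cHS.
Qed.

End WeakPullbackHaar.

Unset Implicit Arguments.
Local Open Scope ereal_scope.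

Theorem theorem4p2 (R : realType) (dS dG dT : measure_display)
  (S : topMeasurableType dS) (G : topMeasurableType dG) (T : topMeasurableType dT)
  (GS : groupoid S) (lamS : S -> {measure set S -> \bar R}) (muS : {measure set S -> \bar R})
  (GG : groupoid G) (lamG : G -> {measure set G -> \bar R}) (muG : {measure set G -> \bar R})
  (GT : groupoid T) (lamT : T -> {measure set T -> \bar R}) (muT : {measure set T -> \bar R})
  (p : S -> G) (q : T -> G) :
  haar_groupoid GS lamS muS -> haar_groupoid GG lamG muG -> haar_groupoid GT lamT muT ->
  haar_hom GS lamS muS GG lamG muG p -> haar_hom GT lamT muT GG lamG muG q ->
  cont_left_Haar_system (wpb GG p q) (wpb_units GS GG GT p q)
    (wpb_r GS GT) (wpb_d GS GG GT p q) (wpb_mul GS GT)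
    (wpb_lam lamS lamT).
Proof.
move=> HS HG HT Hp Hq; split; [|split; [|split]].
- move=> u Pu; split; first exact: (wpb_lam_is_measure lamS HT Pu).
  exact: (wpb_lam_null HS HG HT Hp Hq Pu).
- move=> f; exact: (wpb_lam_continuous HS HG HT Hp Hq).
- move=> x _ E mE EP; exact: (wpb_lam_left_invariant HS HG HT x mE EP).
- move=> u Pu O oO; exact: (wpb_lam_open_gt0 HS HG HT Hp Hq Pu oO).
Qed.
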